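(* Let $A\in\mathbb{R}^{m\times n}$ ($m\ge n$) have full column rank and let $b\in\mathbb{R}^m$, normalized so that $\|A\|=\|b\|=1$. Let $x=\operatorname{argmin}_{x\in\mathbb{R}^n}\|b-Ax\|$ and let $A=\sum_{i=1}^n\sigma_iu_iv_i^\top$ be a singular value decomposition. Then $\widehat x\in\mathbb{R}^n$ is a backward stable solution to the least-squares problem $\min_{x}\|b-Ax\|$ if and only if the component of the error $\widehat x-x$ in the direction of each singular vector satisfies the bound $$\left|v_i^\top(\widehat x-x)\right|\lesssim\sigma_i^{-1}\cdot\left(1+\|\widehat x\|\right)u+\sigma_i^{-2}\cdot\|b-A\widehat x\|\,u\quad\text{for }i=1,\dots,n.$$
   Context: $\|\cdot\|$ is the Euclidean norm of a vector or spectral norm of a matrix; $\|\cdot\|_{\rm F}$ is the Frobenius norm; $u>0$ is the unit roundoff. $a\lesssim b$ means $a\le c(m,n)\,b$ for a prefactor $c(m,n)$ that is a polynomial in $m$ and $n$ (the equivalence is up to changing this polynomial prefactor). Backward stability: the backward error of $\widehat x$ is $\mathrm{BE}(\widehat x)=\min\{\|\Delta A\|_{\rm F}: \widehat x=\operatorname{argmin}_{z\in\mathbb{R}^n}\|b-(A+\Delta A)z\|\}$ (i.e. $\widehat x$ is a minimizer of the perturbed problem); $\widehat x$ is backward stable if $\mathrm{BE}(\widehat x)\le c\,\|A\|_{\rm F}u$ with $c$ a polynomial in $m$ and $n$. *)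

(* Defs.v *)
From HB Require Import structures.
From mathcomp Require Import all_boot all_order all_algebra.
From mathcomp Require Import all_classical all_reals all_analysis.
Set Implicit Arguments.
Unset Strict Implicit.
Unset Printing Implicit Defensive.
Import Order.TTheory GRing.Theory Num.Theory.
Import numFieldNormedType.Exports.
Local Open Scope classical_set_scope.
Local Open Scope ring_scope.

(* The norm `| _ | that the library puts on matrices is the max-entry norm,
   hence the explicit norms below. *)
Definition norm2 (R : realType) (n : nat) (v : 'cV[R]_n) : R :=
  Num.sqrt (\sum_i v i 0 ^+ 2).

Definition normF (R : realType) (m n : nat) (A : 'M[R]_(m, n)) : R :=
  Num.sqrt (\sum_i \sum_j A i j ^+ 2).

Definition spectral_norm (R : realType) (m n : nat) (A : 'M[R]_(m, n)) : R :=
  sup [set norm2 (A *m z) | z in [set z : 'cV[R]_n | norm2 z = 1]].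

Definition dotv (R : realType) (n : nat) (v w : 'cV[R]_n) : R :=
  (v^T *m w) 0 0.

(* x belongs to argmin_z || b - A z || *)
Definition is_lstsq (R : realType) (m n : nat) (A : 'M[R]_(m, n))
    (b : 'cV[R]_m) (x : 'cV[R]_n) : Prop :=
  forall z : 'cV[R]_n, norm2 (b - A *m x) <= norm2 (b - A *m z).

Definition orthonormal (R : realType) (k n : nat) (w : 'I_k -> 'cV[R]_n)
    : Prop :=
  forall i j, dotv (w i) (w j) = (i == j)%:R.

(* Thin singular value decomposition, indexed by 'I_n; the singular values are
   not required to be sorted. *)
Definition is_svd (R : realType) (m n : nat) (A : 'M[R]_(m, n))
    (us : 'I_n -> 'cV[R]_m) (sigma : 'I_n -> R) (vs : 'I_n -> 'cV[R]_n)
    : Prop :=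
  [/\ orthonormal us, orthonormal vs, forall i, 0 <= sigma i
    & A = \sum_i sigma i *: (us i *m (vs i)^T)].

Definition admissible_pert (R : realType) (m n : nat) (A : 'M[R]_(m, n))
    (b : 'cV[R]_m) (xh : 'cV[R]_n) : set 'M[R]_(m, n) :=
  [set dA | is_lstsq (A + dA) b xh].

(* The infimum is a minimum, see backward_error_min below. *)
Definition backward_error (R : realType) (m n : nat) (A : 'M[R]_(m, n))
    (b : 'cV[R]_m) (xh : 'cV[R]_n) : R :=
  inf [set normF dA | dA in admissible_pert A b xh].

(* Evaluation at (m, n) of a real polynomial in two variables. *)
Definition prefactor (R : realType) (c : {poly {poly R}}) (m n : nat) : R :=
  c.[(m%:R)%:P].[n%:R].

Definition backward_stable (R : realType) (c : {poly {poly R}}) (u : R)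
    (m n : nat) (A : 'M[R]_(m, n)) (b : 'cV[R]_m) (xh : 'cV[R]_n) : Prop :=
  backward_error A b xh <= prefactor c m n * normF A * u.

Definition componentwise_error_bound (R : realType) (c : {poly {poly R}})
    (u : R) (m n : nat) (A : 'M[R]_(m, n)) (b : 'cV[R]_m) (x xh : 'cV[R]_n)
    (sigma : 'I_n -> R) (vs : 'I_n -> 'cV[R]_n) : Prop :=
  forall i, `|dotv (vs i) (xh - x)| <= prefactor c m n *
    ((sigma i)^-1 * (1 + norm2 xh) * u
     + (sigma i) ^- 2 * norm2 (b - A *m xh) * u).

Lemma sum_continuous_R (R : realType) (T : topologicalType) (k : nat)
    (f : 'I_k -> T -> R) :
  (forall i, continuous (f i)) -> continuous (fun t => \sum_i f i t).
Proof.
move=> cf t; suff H (r : seq 'I_k) :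
  \sum_(i <- r) f i x @[x --> t] --> \sum_(i <- r) f i t by exact: H.
elim: r => [|i r IH].
  by rewrite big_nil; under eq_fun do rewrite big_nil; exact: cvg_cst.
rewrite big_cons; under eq_fun do rewrite big_cons.
by apply: cvgD => //; exact: cf.
Qed.

Lemma sqr_continuous_R (R : realType) (T : topologicalType) (f : T -> R) :
  continuous f -> continuous (fun t => f t ^+ 2).
Proof.
by move=> cf t; apply: (@cvgM _ _ (nbhs t) _ f f); exact: cf.
Qed.

Lemma entry_le_normF (R : realType) (m n : nat) (E : 'M[R]_(m, n)) i j :
  `|E i j| <= normF E.
Proof.
rewrite -sqrtr_sqr ler_wsqrtr // (bigD1 i) //= (bigD1 j) //= -addrA lerDl.
by rewrite addr_ge0 // sumr_ge0 // => k _; rewrite ?sqr_ge0 ?sumr_ge0 // => l _;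
   rewrite sqr_ge0.
Qed.

Lemma vec_mx_entry_continuous (R : realType) (m n : nat) (i : 'I_m)
    (j : 'I_n) :
  continuous (fun v : 'rV[R]_(m * n) => vec_mx v i j).
Proof.
have -> : (fun v : 'rV[R]_(m * n) => vec_mx v i j)
  = (fun v => v 0 (mxvec_index i j)) by apply/funext => v; rewrite mxE.
exact: coord_continuous.
Qed.

Lemma normF_vec_mx_continuous (R : realType) (m n : nat) :
  continuous (fun v : 'rV[R]_(m * n) => normF (vec_mx v)).
Proof.
move=> v; apply: (@continuous_comp _ _ _ _ Num.sqrt); last exact: sqrt_continuous.
move: v; apply: sum_continuous_R => i; apply: sum_continuous_R => j.
exact/sqr_continuous_R/vec_mx_entry_continuous.
Qed.

Lemma residual_continuous (R : realType) (m n : nat) (A : 'M[R]_(m, n))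
    (b : 'cV[R]_m) (z : 'cV[R]_n) :
  continuous (fun v : 'rV[R]_(m * n) => norm2 (b - (A + vec_mx v) *m z)).
Proof.
move=> v; apply: (@continuous_comp _ _ _ _ Num.sqrt); last exact: sqrt_continuous.
move: v; apply: sum_continuous_R => i; apply: sqr_continuous_R.
have -> : (fun v : 'rV[R]_(m * n) => (b - (A + vec_mx v) *m z) i 0)
   = (fun v => b i 0 - \sum_j (A i j + vec_mx v i j) * z j 0).
  apply/funext => w; rewrite !mxE; congr (_ - _).
  by apply: eq_bigr => j _; rewrite !mxE.
move=> v; apply: (@cvgB _ _ _ (nbhs v) _ (fun=> b i 0)
  (fun w => \sum_j (A i j + vec_mx w i j) * z j 0)); first exact: cvg_cst.
apply: (@sum_continuous_R _ _ _
  (fun j w => (A i j + vec_mx w i j) * z j 0)) => j {}v.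
apply: (@cvgM _ _ (nbhs v) _ (fun w => A i j + vec_mx w i j) (fun=> z j 0)).
  apply: (@cvgD _ _ _ (nbhs v) _ (fun=> A i j)); first exact: cvg_cst.
  exact: vec_mx_entry_continuous.
exact: cvg_cst.
Qed.

Lemma backward_error_min (R : realType) (m n : nat) (A : 'M[R]_(m, n))
    (b : 'cV[R]_m) (xh : 'cV[R]_n) :
  exists2 dA, admissible_pert A b xh dA &
    backward_error A b xh = normF dA /\
    forall dA', admissible_pert A b xh dA' -> normF dA <= normF dA'.
Proof.
pose K := [set v : 'rV[R]_(m * n) | normF (vec_mx v) <= normF A] `&`
  \bigcap_(z in [set: 'cV[R]_n]) [set v : 'rV[R]_(m * n) |
    0 <= norm2 (b - (A + vec_mx v) *m z) - norm2 (b - (A + vec_mx v) *m xh)].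
have KP v : normF (vec_mx v) <= normF A -> admissible_pert A b xh (vec_mx v) ->
    K v by move=> vA adm; split=> //= z _ /=; rewrite subr_ge0; exact: adm.
have K0 : K !=set0.
  exists (mxvec (- A)); apply: KP; rewrite mxvecK; last first.
    by move=> z; rewrite subrr !mul0mx.
  rewrite /normF; under eq_bigr do under eq_bigr do rewrite mxE sqrrN.
  exact: lexx.
have clK : closed K.
  apply: closedI.
    apply: (@preimage_closed _ _ (fun v => normF (vec_mx v))
             [set x | x <= normF A]); last exact: closed_le.
    by move=> v _; exact: normF_vec_mx_continuous.
  apply: closed_bigI => z _.
  apply: (@preimage_closed _ _ (fun v => norm2 (b - (A + vec_mx v) *m z) -
      norm2 (b - (A + vec_mx v) *m xh)) [set x : R | 0 <= x]);
    last exact: closed_ge.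
  by move=> v _; apply: (@cvgB _ _ _ (nbhs v)); exact: residual_continuous.
have cK : compact K.
  apply: bounded_closed_compact => //.
  exists (normF A); split; first exact: num_real.
  move=> M AM v [/= vA _]; apply: (le_trans _ (ltW AM)).
  change (mx_norm v <= normF A).
  have [->|/mx_norm_neq0[[i k] ->]] := eqVneq (mx_norm v) 0.
    exact: sqrtr_ge0.
  apply: le_trans vA; rewrite (ord1 i) /=; case/mxvec_indexP: k => k l.
  by apply: le_trans (entry_le_normF _ k l); rewrite mxE.
have [v /set_mem[/= vA vK] vmin] := compact_EVT_min K0 cK
  (continuous_subspaceT (@normF_vec_mx_continuous R m n)).
have adm : admissible_pert A b xh (vec_mx v).
  by move=> z; have := vK z I; rewrite /= subr_ge0.
have min E : admissible_pert A b xh E -> normF (vec_mx v) <= normF E.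
  move=> aE; have [EA|/ltW AE] := leP (normF E) (normF A); last exact: le_trans AE.
  by rewrite -[E]mxvecK; apply: vmin; rewrite inE; apply: KP; rewrite mxvecK.
exists (vec_mx v) => //; split=> //.
apply/eqP; rewrite eq_le; apply/andP; split.
  apply: ge_inf; last by exists (vec_mx v).
  by exists (normF (vec_mx v)) => _ [E aE <-]; exact: min.
apply: lb_le_inf; first by exists (normF (vec_mx v)), (vec_mx v).
by move=> _ [E aE <-]; exact: min.
Qed.

(* Main.v *)
Require Import Defs.
From HB Require Import structures.
From mathcomp Require Import all_boot all_order all_algebra.
From mathcomp Require Import all_classical all_reals all_analysis.
From mathcomp Require Import ring lra.
Set Implicit Arguments.
Unset Strict Implicit.
Unset Printing Implicit Defensive.
Import Order.TTheory GRing.Theory Num.Theory.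
Local Open Scope ring_scope.

(** Write r = b - A xh for the residual and rho_i = u_i^T r.  Since A^T kills
    the optimal residual b - A x, the error satisfies
    sigma_i v_i^T (xh - x) = - rho_i ([svd_error_component]).  Moreover
    1 = |b| <= |r| + |xh| and sigma_i <= 1, so that the constant 1 in the
    componentwise bound can be absorbed and the bound says, up to a constant,
      sigma_i |rho_i| <= K (sigma_i |xh| + |r|)   for all i,
    where K is a prefactor times the unit roundoff.  It remains to compare the
    backward error with the least such K.

    Suppose that E is an admissible perturbation of norm e, and let
    s = r - E xh be the residual of the perturbed problem.  Its normal
    equations, tested against v_i, give
      sigma_i rho_i = sigma_i u_i^T E xh - (E v_i)^T s,
    whose right side is at most e (2 sigma_i |xh| + |r|) as long as
    e <= sigma_i.  If sigma_i < e, then the trivial bound |rho_i| <= |r|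
    suffices ([admissible_pert_residual_bound]).  Treating the two cases apart
    is what makes the equivalence hold for every u > 0 and not just
    asymptotically.

    Conversely, for any splitting r = (r - w) + w into orthogonal parts,
      E = (r - w) xh^+ - w w^+ A
    is admissible: the first term makes xh fit the part r - w exactly, and the
    second one makes the columns of A + E orthogonal to the remaining residual,
    which is a multiple of w ([split_pert_admissible]).  Its norm is at most
    |r - w| / |xh| + |A^T w| / |w| ([normF_split_pert]).  Fit the components of
    r along those u_i with |r| <= sigma_i |xh|, and let w be the rest: for the
    fitted indices the bound on rho_i reads |rho_i| <= 2 K |xh|, for the other
    ones sigma_i |rho_i| <= 2 K |r|.  This controls both quotients, provided
    that |w| is comparable to |r|; if it is not, then |r - w| is, and w = 0
    works instead ([backward_error_le_residual]).

    Both directions hold with the prefactor 12 n c(m, n). *)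

(** * Inner products and norms *)

Lemma dotvE (R : realType) n (v w : 'cV[R]_n) :
  dotv v w = \sum_i v i 0 * w i 0.
Proof. by rewrite /dotv mxE; apply: eq_bigr => i _; rewrite mxE. Qed.

Lemma dotvC (R : realType) n (v w : 'cV[R]_n) : dotv v w = dotv w v.
Proof. by rewrite !dotvE; apply: eq_bigr => i _; rewrite mulrC. Qed.

Lemma dotvDr (R : realType) n (v w z : 'cV[R]_n) :
  dotv v (w + z) = dotv v w + dotv v z.
Proof. by rewrite /dotv mulmxDr mxE. Qed.

Lemma dotvNr (R : realType) n (v w : 'cV[R]_n) : dotv v (- w) = - dotv v w.
Proof. by rewrite /dotv mulmxN mxE. Qed.

Lemma dotvZr (R : realType) n (v w : 'cV[R]_n) k :
  dotv v (k *: w) = k * dotv v w.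
Proof. by rewrite /dotv -scalemxAr mxE. Qed.

Lemma dotv0r (R : realType) n (v : 'cV[R]_n) : dotv v 0 = 0.
Proof. by rewrite /dotv mulmx0 mxE. Qed.

Lemma dotv_sumr (R : realType) n (I : finType) (P : pred I) (v : 'cV[R]_n)
    (w : I -> 'cV[R]_n) :
  dotv v (\sum_(i | P i) w i) = \sum_(i | P i) dotv v (w i).
Proof. by rewrite /dotv mulmx_sumr summxE. Qed.

Lemma dotvDl (R : realType) n (v w z : 'cV[R]_n) :
  dotv (w + z) v = dotv w v + dotv z v.
Proof. by rewrite dotvC dotvDr !(dotvC v). Qed.

Lemma dotvNl (R : realType) n (v w : 'cV[R]_n) : dotv (- w) v = - dotv w v.
Proof. by rewrite dotvC dotvNr (dotvC v). Qed.

Lemma dotvZl (R : realType) n (v w : 'cV[R]_n) k :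
  dotv (k *: w) v = k * dotv w v.
Proof. by rewrite dotvC dotvZr (dotvC v). Qed.

Lemma dotv_mulmx (R : realType) m n (A : 'M[R]_(m, n)) v w :
  dotv v (A *m w) = dotv (A^T *m v) w.
Proof. by rewrite /dotv trmx_mul trmxK mulmxA. Qed.

Lemma dotv_ge0 (R : realType) n (v : 'cV[R]_n) : 0 <= dotv v v.
Proof. by rewrite dotvE sumr_ge0 // => i _; rewrite -expr2 sqr_ge0. Qed.

Lemma dotv_eq0 (R : realType) n (v : 'cV[R]_n) : (dotv v v == 0) = (v == 0).
Proof.
apply/eqP/eqP => [|->]; last exact: dotv0r.
rewrite dotvE => /psumr_eq0P H; apply/matrixP => i j; rewrite (ord1 j) mxE.
by apply/eqP; rewrite -sqrf_eq0 expr2 H // => k _; rewrite -expr2 sqr_ge0.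
Qed.

Lemma norm2E (R : realType) n (v : 'cV[R]_n) : norm2 v = Num.sqrt (dotv v v).
Proof. by rewrite dotvE; congr Num.sqrt; apply: eq_bigr => i _; rewrite expr2. Qed.

Lemma norm2_ge0 (R : realType) n (v : 'cV[R]_n) : 0 <= norm2 v.
Proof. exact: sqrtr_ge0. Qed.

Lemma sqr_norm2 (R : realType) n (v : 'cV[R]_n) : norm2 v ^+ 2 = dotv v v.
Proof. by rewrite norm2E sqr_sqrtr ?dotv_ge0. Qed.

Lemma norm2_eq0 (R : realType) n (v : 'cV[R]_n) : (norm2 v == 0) = (v == 0).
Proof. by rewrite -sqrf_eq0 sqr_norm2 dotv_eq0. Qed.

Lemma norm2_0 (R : realType) n : norm2 (0 : 'cV[R]_n) = 0.
Proof. by apply/eqP; rewrite norm2_eq0. Qed.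

Lemma norm2Z (R : realType) n k (v : 'cV[R]_n) : norm2 (k *: v) = `|k| * norm2 v.
Proof.
by rewrite !norm2E dotvZl dotvZr mulrA -expr2 sqrtrM ?sqr_ge0 // sqrtr_sqr.
Qed.

Lemma norm2N (R : realType) n (v : 'cV[R]_n) : norm2 (- v) = norm2 v.
Proof. by rewrite -scaleN1r norm2Z normrN1 mul1r. Qed.

(** Expand the square of the norm of (v . v) w - (v . w) v and divide by
    v . v. *)
Lemma cauchy_schwarz (R : realType) n (v w : 'cV[R]_n) :
  `|dotv v w| <= norm2 v * norm2 w.
Proof.
rewrite -ler_sqr ?nnegrE ?mulr_ge0 ?norm2_ge0 // real_normK ?num_real //.
rewrite exprMn !sqr_norm2.
have [->|v0] := eqVneq v 0; first by rewrite dotvC !dotv0r expr0n mul0r.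
have vv0 : 0 < dotv v v by rewrite lt_def dotv_eq0 v0 dotv_ge0.
have := dotv_ge0 (dotv v v *: w - dotv v w *: v).
rewrite !(dotvDl, dotvNl, dotvZl, dotvDr, dotvNr, dotvZr) (dotvC w v).
set a := dotv v v; set k := dotv v w; set d := dotv w w => H.
by rewrite -subr_ge0 -(pmulr_rge0 _ vv0) -/a; apply: le_trans H _; lra.
Qed.

Lemma sqr_norm2D (R : realType) n (v w : 'cV[R]_n) :
  norm2 (v + w) ^+ 2 = norm2 v ^+ 2 + 2 * dotv v w + norm2 w ^+ 2.
Proof. by rewrite !sqr_norm2 dotvDl !dotvDr (dotvC w v); ring. Qed.

Lemma norm2D (R : realType) n (v w : 'cV[R]_n) : norm2 (v + w) <= norm2 v + norm2 w.
Proof.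
rewrite -ler_sqr ?nnegrE ?addr_ge0 ?norm2_ge0 // sqr_norm2D sqrrD.
by have := le_trans (ler_norm _) (cauchy_schwarz v w); lra.
Qed.

Lemma norm2_sum (R : realType) n (I : finType) (P : pred I) (w : I -> 'cV[R]_n) :
  norm2 (\sum_(i | P i) w i) <= \sum_(i | P i) norm2 (w i).
Proof.
elim/big_ind2: _ => //; first by rewrite norm2_0.
by move=> v a z b va zb; apply: le_trans (norm2D _ _) (lerD va zb).
Qed.

Lemma normF_mxvec (R : realType) m n (A : 'M[R]_(m, n)) :
  normF A = norm2 (mxvec A)^T.
Proof.
congr Num.sqrt; rewrite pair_bigA /=.
rewrite (reindex _ (curry_mxvec_bij _ _)) /=.
by apply: eq_bigr => -[i j] _; rewrite mxE mxvecE.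
Qed.

Lemma normF_ge0 (R : realType) m n (A : 'M[R]_(m, n)) : 0 <= normF A.
Proof. exact: sqrtr_ge0. Qed.

Lemma normF0 (R : realType) m n : normF (0 : 'M[R]_(m, n)) = 0.
Proof. by rewrite normF_mxvec !linear0 norm2_0. Qed.

Lemma normFD (R : realType) m n (A B : 'M[R]_(m, n)) :
  normF (A + B) <= normF A + normF B.
Proof. by rewrite !normF_mxvec !linearD norm2D. Qed.

Lemma normFZ (R : realType) m n k (A : 'M[R]_(m, n)) :
  normF (k *: A) = `|k| * normF A.
Proof. by rewrite !normF_mxvec !linearZ norm2Z. Qed.

Lemma normF_outer (R : realType) m n (v : 'cV[R]_m) (w : 'cV[R]_n) :
  normF (v *m w^T) = norm2 v * norm2 w.
Proof.
rewrite -sqrtrM ?sumr_ge0 // => [|i _]; last exact: sqr_ge0.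
congr Num.sqrt; rewrite mulr_suml; apply: eq_bigr => i _.
rewrite mulr_sumr; apply: eq_bigr => j _.
by rewrite mxE big_ord_recl big_ord0 addr0 mxE exprMn.
Qed.

(** Cauchy-Schwarz for each row of A. *)
Lemma norm2_mulmx (R : realType) m n (A : 'M[R]_(m, n)) z :
  norm2 (A *m z) <= normF A * norm2 z.
Proof.
rewrite -sqrtrM; last by do 2![apply: sumr_ge0 => ? _]; exact: sqr_ge0.
rewrite ler_wsqrtr // mulr_suml; apply: ler_sum => i _.
have -> : (A *m z) i 0 = dotv (row i A)^T z.
  by rewrite /dotv trmxK -row_mul [RHS]mxE.
rewrite -real_normK ?num_real //.
apply: le_trans (_ : (norm2 (row i A)^T * norm2 z) ^+ 2 <= _).
  by rewrite ler_sqr ?nnegrE ?mulr_ge0 ?norm2_ge0 ?cauchy_schwarz.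
rewrite exprMn !sqr_norm2 !dotvE le_eqVlt; apply/orP; left.
by apply/eqP; congr (_ * _); apply: eq_bigr => j _; rewrite ?mxE expr2.
Qed.

Lemma norm2_mulmx_spectral (R : realType) m n (A : 'M[R]_(m, n)) z :
  norm2 (A *m z) <= spectral_norm A * norm2 z.
Proof.
have [->|z0] := eqVneq z 0; first by rewrite mulmx0 !norm2_0 mulr0.
have nz : 0 < norm2 z by rewrite lt_def norm2_eq0 z0 norm2_ge0.
rewrite -ler_pdivrMr //; apply: ub_le_sup.
  by exists (normF A) => _ [y /= y1 <-]; rewrite -[leRHS]mulr1 -y1 norm2_mulmx.
exists ((norm2 z)^-1 *: z) => /=.
  by rewrite norm2Z gtr0_norm ?invr_gt0 // mulVf // gt_eqF.
by rewrite -scalemxAr norm2Z gtr0_norm ?invr_gt0 // mulrC.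
Qed.

Lemma spectral_norm_le_normF (R : realType) m n (A : 'M[R]_(m, n)) :
  spectral_norm A <= normF A.
Proof.
rewrite /spectral_norm; set S := (X in sup X).
have [->|S0] := eqVneq S classical_sets.set0; first by rewrite sup0 normF_ge0.
apply: ge_sup; first exact/set0P.
by move=> _ [y /= y1 <-]; rewrite -[leRHS]mulr1 -y1 norm2_mulmx.
Qed.

(** * Least squares and singular values *)

(** If g = A^T r is not zero, then a short step from x along g decreases the
    residual.  Conversely, A^T r = 0 makes r orthogonal to the range of A, and
    Pythagoras applies. *)
Lemma is_lstsq_normal_eq (R : realType) m n (A : 'M[R]_(m, n)) b x :
  is_lstsq A b x <-> A^T *m (b - A *m x) = 0.
Proof.
set r := b - A *m x; split=> [Ax|Ar z].
  set g := A^T *m r; set d := dotv (A *m g) (A *m g).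
  have d0 : 0 <= d := dotv_ge0 _.
  have dg : dotv r (A *m g) = dotv g g by rewrite dotv_mulmx.
  (* The step length of steepest descent is g.g / d; the added 1 avoids
     dividing by zero and still gives a decrease. *)
  pose t := dotv g g / (d + 1).
  have := Ax (x + t *: g).
  rewrite mulmxDr opprD addrA -/r -ler_sqr ?nnegrE ?norm2_ge0 // (sqr_norm2D r).
  rewrite -scalemxAr -scaleNr norm2Z exprMn real_normK ?num_real // !sqr_norm2.
  rewrite dotvZr dg -/d => H.
  have tE : dotv g g = t * (d + 1) by rewrite /t divfK // gt_eqF // ltr_wpDl.
  apply/eqP; rewrite -dotv_eq0 tE mulf_eq0; apply/orP; left.
  rewrite -sqrf_eq0; rewrite eq_le sqr_ge0 andbT.
  have t2d : 0 <= t ^+ 2 * d by rewrite mulr_ge0 ?sqr_ge0.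
  by rewrite tE in H; lra.
have -> : b - A *m z = r + A *m (x - z).
  by rewrite mulmxBr addrA subrK.
rewrite -ler_sqr ?nnegrE ?norm2_ge0 // (sqr_norm2D r) dotv_mulmx Ar dotvC dotv0r.
by rewrite mulr0 addr0 lerDl sqr_ge0.
Qed.

Lemma backward_error_le (R : realType) m n (A : 'M[R]_(m, n)) b xh E :
  admissible_pert A b xh E -> backward_error A b xh <= normF E.
Proof. by have [F _ [-> Fmin]] := backward_error_min A b xh; exact: Fmin. Qed.

Lemma orthonormal_norm2 (R : realType) k p (w : 'I_k -> 'cV[R]_p) i :
  Defs.orthonormal w -> norm2 (w i) = 1.
Proof. by move=> ow; rewrite norm2E ow eqxx sqrtr1. Qed.

Section Svd.
Variables (R : realType) (m n : nat) (A : 'M[R]_(m, n)).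
Variables (us : 'I_n -> 'cV[R]_m) (sigma : 'I_n -> R) (vs : 'I_n -> 'cV[R]_n).
Hypothesis svd : is_svd A us sigma vs.

Lemma svd_mul_tr y : A^T *m y = \sum_i (sigma i * dotv (us i) y) *: vs i.
Proof.
case: svd => _ _ _ ->; rewrite linear_sum mulmx_suml; apply: eq_bigr => i _.
rewrite linearZ /= trmx_mul trmxK -scalemxAl -mulmxA -scalerA; congr (_ *: _).
by rewrite [_ *m y]mx11_scalar mul_mx_scalar.
Qed.

Lemma svd_left i : A^T *m us i = sigma i *: vs i.
Proof.
rewrite svd_mul_tr (bigD1 i) //= big1 => [|j ji]; last first.
  by case: svd => -> _ _ _; rewrite (negPf ji) mulr0 scale0r.
by case: svd => -> _ _ _; rewrite eqxx mulr1 addr0.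
Qed.

Lemma svd_right i : A *m vs i = sigma i *: us i.
Proof.
case: svd => _ ov _ ->; rewrite mulmx_suml (bigD1 i) //= big1 => [|j ji].
  rewrite -scalemxAl -mulmxA [_ *m vs i]mx11_scalar -/(dotv _ _) ov eqxx.
  by rewrite mulmx1 addr0.
rewrite -scalemxAl -mulmxA [_ *m vs i]mx11_scalar -/(dotv _ _) ov.
by rewrite (negPf ji) raddf0 mulmx0 scaler0.
Qed.

Lemma svd_sigma_le i : sigma i <= spectral_norm A.
Proof.
case: (svd) => ou ov s0 _; have := norm2_mulmx_spectral A (vs i).
by rewrite svd_right norm2Z ger0_norm // !orthonormal_norm2 // !mulr1.
Qed.

Lemma svd_sigma_gt0 i : \rank A = n -> 0 < sigma i.
Proof.
move=> rA; case: (svd) => _ ov s0 _; rewrite lt_def s0 andbT.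
apply/eqP => si0; have /row_fullP[B BA] : row_full A by rewrite /row_full rA.
have : B *m (A *m vs i) = vs i by rewrite mulmxA BA mul1mx.
rewrite svd_right si0 scale0r mulmx0 => /esym v0.
by have := orthonormal_norm2 i ov; rewrite v0 norm2_0 => /esym/eqP; rewrite oner_eq0.
Qed.

Lemma normF_le_spectral : normF A <= n%:R * spectral_norm A.
Proof.
have {1}-> : A = \sum_i sigma i *: (us i *m (vs i)^T) by case: svd.
apply: le_trans (_ : \sum_i sigma i <= _); last first.
  apply: le_trans (ler_sum _ (fun i _ => svd_sigma_le i)) _.
  by rewrite sumr_const card_ord mulr_natl.
elim/big_ind2: _ => [||i _]; first by rewrite normF0.
  by move=> M a N b Ma Nb; apply: le_trans (normFD _ _) (lerD Ma Nb).
case: svd => ou ov s0 _.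
by rewrite normFZ normF_outer !orthonormal_norm2 // !mulr1 ger0_norm.
Qed.

(** Because sigma_i u_i = A v_i, the optimal residual is orthogonal to u_i;
    hence u_i cannot distinguish A x from b. *)
Lemma svd_error_component b x xh i : 0 < sigma i -> is_lstsq A b x ->
  sigma i * dotv (vs i) (xh - x) = - dotv (us i) (b - A *m xh).
Proof.
move=> si /is_lstsq_normal_eq Ax.
have ux : dotv (us i) (b - A *m x) = 0.
  apply: (mulfI (lt0r_neq0 si)).
  by rewrite -dotvZl -svd_right dotvC dotv_mulmx Ax dotvC dotv0r mulr0.
rewrite -dotvZl -svd_left -dotv_mulmx mulmxBr.
have -> : A *m xh - A *m x = (b - A *m x) - (b - A *m xh).
  by rewrite opprB [RHS]addrC addrA subrK.
by rewrite dotvDr ux add0r dotvNr.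
Qed.

End Svd.

(** * Perturbations from an orthogonal splitting of the residual *)

Section SplitPerturbation.
Variables (R : realType) (m n : nat) (A : 'M[R]_(m, n)).
Variables (b : 'cV[R]_m) (xh : 'cV[R]_n) (w : 'cV[R]_m).
Let r := b - A *m xh.

(** The matrix (r - w) xh^+ - w w^+ A, where v^+ = v^T / |v|^2 is the
    pseudo-inverse of a vector; division by zero being zero, 0^+ = 0 as it
    should.  The choice w = 0 makes xh fit b exactly, the choice w = r
    changes A just so far that its columns become orthogonal to r. *)
Definition split_pert : 'M[R]_(m, n) :=
  (norm2 xh ^- 2 *: ((r - w) *m xh^T))
  - (norm2 w ^- 2 *: (w *m (A^T *m w)^T)).

(** The perturbed residual is a multiple of w, and w^T E = - w^T A because w is
    orthogonal to r - w.  If xh = 0, then no perturbation changes the residual,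
    so that nothing can be fitted: this is the condition w = r. *)
Lemma split_pert_admissible :
  dotv w (r - w) = 0 -> (xh = 0 -> w = r) -> admissible_pert A b xh split_pert.
Proof.
move=> wrw xh0; apply/is_lstsq_normal_eq.
have pinv p (v : 'cV[R]_p) (y : 'cV[R]_m) : (v = 0 -> y = 0) ->
    norm2 v ^- 2 *: (y *m v^T *m v) = y.
  move=> v0; have [/eqP|nv] := eqVneq (norm2 v) 0.
    by rewrite norm2_eq0 => /eqP /v0 ->; rewrite !mul0mx scaler0.
  rewrite -mulmxA [_^T *m _]mx11_scalar -/(dotv _ _) mul_mx_scalar -sqr_norm2.
  by rewrite scalerA mulVf ?scale1r // expf_neq0.
pose k := norm2 w ^- 2 * dotv (A^T *m w) xh.
have res : b - (A + split_pert) *m xh = (1 + k) *: w.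
  rewrite mulmxDl opprD addrA -/r /split_pert mulmxBl -!scalemxAl pinv.
    rewrite -mulmxA [_^T *m xh]mx11_scalar -/(dotv _ _) mul_mx_scalar scalerA.
    by rewrite -/k scalerDl scale1r opprB addrCA subKr addrC.
  by move=> /xh0 ->; rewrite subrr.
have Ew : split_pert^T *m w = - (A^T *m w).
  have trZ k1 p q (M : 'M[R]_(p, q)) : (k1 *: M)^T = k1 *: M^T by exact: linearZ.
  rewrite /split_pert linearB /= !trZ !trmx_mul !trmxK mulmxBl -!scalemxAl.
  rewrite -!mulmxA.
  have -> : (r - w)^T *m w = 0.
    by rewrite [LHS]mx11_scalar -/(dotv _ _) dotvC wrw raddf0.
  rewrite !mulmx0 scaler0 sub0r; congr (- _).
  by rewrite (mulmxA w) scalemxAr pinv.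
by rewrite res -scalemxAr linearD mulmxDl Ew subrr scaler0.
Qed.

Lemma normF_split_pert :
  normF split_pert <= norm2 (r - w) / norm2 xh + norm2 (A^T *m w) / norm2 w.
Proof.
have inv2 (a k : R) : 0 <= k -> `|k ^- 2| * (a * k) = a / k.
  move=> k0; rewrite ger0_norm ?invr_ge0 ?sqr_ge0 //.
  have [->|kn0] := eqVneq k 0; first by rewrite !(mulr0, invr0).
  by field.
rewrite /split_pert -scaleNr; apply: le_trans (normFD _ _) _.
rewrite !normFZ normrN !normF_outer inv2 ?norm2_ge0 //.
by rewrite (mulrC (norm2 w)) inv2 ?norm2_ge0.
Qed.

End SplitPerturbation.

(** With the convention a / 0 = 0 this covers d = 0, so that vanishing
    denominators need no separate treatment below. *)
Lemma ler_pdiv_of_mul (R : realType) (a d k : R) :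
  0 <= d -> 0 <= k -> a <= k * d -> a / d <= k.
Proof.
rewrite le_eqVlt => /predU1P[<-|d0] k0 H; first by rewrite invr0 mulr0.
by rewrite ler_pdivrMr.
Qed.

(** * Backward error against the residual components *)

Section Bounds.
Variables (R : realType) (m n : nat) (A : 'M[R]_(m, n)).
Variables (us : 'I_n -> 'cV[R]_m) (sigma : 'I_n -> R) (vs : 'I_n -> 'cV[R]_n).
Variables (b : 'cV[R]_m) (xh : 'cV[R]_n).
Hypotheses (svd : is_svd A us sigma vs) (sigma_gt0 : forall i, 0 < sigma i).
Let r := b - A *m xh.

(** Let e = |E|, and let s be the residual of the perturbed problem.  Bounding
    (E v_i)^T s brings in the second-order quantity e^2 |xh|.  It is harmless
    only if e <= sigma_i; otherwise sigma_i < e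
    already gives sigma_i |rho_i| <= e |r|. *)
Lemma admissible_pert_residual_bound E i : admissible_pert A b xh E ->
  sigma i * `|dotv (us i) r|
    <= 2 * normF E * (sigma i * norm2 xh + norm2 r).
Proof.
move=> /is_lstsq_normal_eq EA; case: (svd) => ou ov _ _.
set e := normF E; have e0 : 0 <= e := normF_ge0 E.
have si := sigma_gt0 i.
have xh0 := norm2_ge0 xh; have r0 := norm2_ge0 r.
have [sie|esi] := ltP (sigma i) e.
  have := cauchy_schwarz (us i) r; rewrite (orthonormal_norm2 _ ou) mul1r => H.
  have H1 : sigma i * `|dotv (us i) r| <= e * norm2 r.
    by apply: ler_pM => //; rewrite ltW.
  have H2 : 0 <= e * (sigma i * norm2 xh) by rewrite !mulr_ge0 // ltW.
  have H3 : 0 <= e * norm2 r by rewrite mulr_ge0.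
  by lra.
set s := b - (A + E) *m xh in EA.
have rE : r = s + E *m xh by rewrite /s mulmxDl opprD addrA subrK.
have sn : norm2 s <= norm2 r + e * norm2 xh.
  have -> : s = r - E *m xh by rewrite rE addrK.
  by apply: le_trans (norm2D _ _) _; rewrite norm2N lerD2l norm2_mulmx.
have sE : sigma i * dotv (us i) r
    = sigma i * dotv (us i) (E *m xh) - dotv (E *m vs i) s.
  have vs0 : dotv ((A + E) *m vs i) s = 0.
    by rewrite dotvC dotv_mulmx EA dotvC dotv0r.
  rewrite rE dotvDr mulrDr addrC; congr (_ + _); apply/eqP.
  by rewrite -addr_eq0 -dotvZl -(svd_right svd) -dotvDl -mulmxDl vs0.
have B1 : `|dotv (us i) (E *m xh)| <= e * norm2 xh.
  apply: le_trans (cauchy_schwarz _ _) _.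
  by rewrite (orthonormal_norm2 _ ou) mul1r norm2_mulmx.
have B2 : `|dotv (E *m vs i) s| <= e * (norm2 r + sigma i * norm2 xh).
  apply: le_trans (cauchy_schwarz _ _) _; apply: ler_pM; rewrite ?norm2_ge0 //.
    by have := norm2_mulmx E (vs i); rewrite (orthonormal_norm2 _ ov) mulr1.
  by apply: le_trans sn _; rewrite lerD2l ler_wpM2r.
rewrite -{1}(gtr0_norm si) -normrM sE; apply: le_trans (ler_normB _ _) _.
rewrite normrM (gtr0_norm si).
have B3 : sigma i * `|dotv (us i) (E *m xh)| <= sigma i * (e * norm2 xh).
  by rewrite ler_wpM2l // ltW.
have H3 : 0 <= e * norm2 r by rewrite mulr_ge0.
by lra.
Qed.

(** The index i is fitted when sigma_i |xh| is the dominant term of the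
    hypothesis.  Here p is the fitted part of r, and s the rest.  The splitting
    uses w = s, unless |s| < |r| / 2: then dividing by |s| is too costly, and
    w = 0 is used, for which |r| <= 2 |p| gives the bound. *)
Lemma backward_error_le_residual K : 0 <= K ->
  (forall i, sigma i * `|dotv (us i) r| <= K * (sigma i * norm2 xh + norm2 r)) ->
  backward_error A b xh <= 6 * n%:R * K.
Proof.
move=> K0 HK; case: (svd) => ou ov _ _.
pose big i := norm2 r <= sigma i * norm2 xh.
pose p := \sum_(i | big i) dotv (us i) r *: us i.
pose s := r - p.
have N0 : 0 <= n%:R :> R by exact: ler0n.
have NK0 : 0 <= n%:R * K by rewrite mulr_ge0.
have xh0 := norm2_ge0 xh; have r0 := norm2_ge0 r; have s0 := norm2_ge0 s.
have sum_le (P : pred 'I_n) (f : 'I_n -> R) k : 0 <= k ->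
    (forall i, P i -> f i <= k) -> \sum_(i | P i) f i <= n%:R * k.
  move=> k0 fk; rewrite big_mkcond mulr_natl -[X in _ *+ X]card_ord -sumr_const.
  by apply: ler_sum => i _; case: ifP => // /fk.
have up i : dotv (us i) p = if big i then dotv (us i) r else 0.
  rewrite /p dotv_sumr; case: ifP => bi.
    rewrite (bigD1 i) //= big1 => [|j /andP[_ ji]].
      by rewrite dotvZr ou eqxx mulr1 addr0.
    by rewrite dotvZr ou eq_sym (negPf ji) mulr0.
  rewrite big1 // => j bj; rewrite dotvZr ou; case: eqP => [ij|_].
    by rewrite ij bj in bi.
  by rewrite mulr0.
have ps : dotv s p = 0.
  rewrite /p dotv_sumr big1 // => i bi.
  by rewrite dotvZr (dotvC s) /s dotvDr dotvNr up bi subrr mulr0.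
have p_le : norm2 p <= 2 * (n%:R * K) * norm2 xh.
  apply: le_trans (norm2_sum _ _) _.
  rewrite (_ : _ * norm2 xh = n%:R * (2 * K * norm2 xh)); last by ring.
  apply: sum_le => [|i bi]; first by rewrite !mulr_ge0.
  rewrite norm2Z (orthonormal_norm2 _ ou) mulr1 -(ler_pM2l (sigma_gt0 i)).
  apply: le_trans (HK i) _.
  have -> : sigma i * (2 * K * norm2 xh)
      = K * (sigma i * norm2 xh + sigma i * norm2 xh) by ring.
  by rewrite ler_wpM2l // lerD2l.
have As_le : norm2 (A^T *m s) <= 2 * (n%:R * K) * norm2 r.
  rewrite (svd_mul_tr svd); apply: le_trans (norm2_sum _ _) _.
  rewrite (_ : _ * norm2 r = n%:R * (2 * K * norm2 r)); last by ring.
  apply: sum_le => [|i _]; first by rewrite !mulr_ge0.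
  rewrite norm2Z (orthonormal_norm2 _ ov) mulr1 /s dotvDr dotvNr up.
  case: ifPn => [_|bi]; first by rewrite subrr mulr0 normr0 !mulr_ge0.
  rewrite subr0 normrM gtr0_norm //; apply: le_trans (HK i) _.
  rewrite (_ : 2 * K * norm2 r = K * (norm2 r + norm2 r)); last by ring.
  by rewrite ler_wpM2l // lerD2r ltW // ltNge.
have rsp : r = s + p by rewrite subrK.
have p0 : xh = 0 -> p = 0.
  move=> x0; apply/eqP; rewrite -norm2_eq0 eq_le norm2_ge0 andbT.
  by apply: le_trans p_le _; rewrite x0 norm2_0 mulr0.
have bound w : dotv w (r - w) = 0 -> (xh = 0 -> w = r) ->
    backward_error A b xh
      <= norm2 (r - w) / norm2 xh + norm2 (A^T *m w) / norm2 w.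
  move=> wrw x0; apply: le_trans (normF_split_pert A b xh w).
  exact/backward_error_le/split_pert_admissible.
have [rs|sr] := leP (norm2 r) (2 * norm2 s).
  have rs_p : r - s = p by rewrite opprB addrC subrK.
  apply: le_trans (bound s _ _) _; first by rewrite rs_p.
    by move=> /p0 p00; rewrite rsp p00 addr0.
  rewrite rs_p.
  have H1 : norm2 p / norm2 xh <= 2 * (n%:R * K).
    by apply: ler_pdiv_of_mul => //; rewrite mulr_ge0.
  have H2 : norm2 (A^T *m s) / norm2 s <= 4 * (n%:R * K).
    apply: ler_pdiv_of_mul => //; first by rewrite mulr_ge0.
    apply: le_trans As_le _.
    rewrite (_ : 4 * _ * _ = 2 * (n%:R * K) * (2 * norm2 s)); last by ring.
    by rewrite ler_wpM2l // mulr_ge0.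
  by lra.
have rp : norm2 r <= 2 * norm2 p.
  by have := norm2D s p; rewrite -rsp; lra.
apply: le_trans (bound 0 _ _) _; first by rewrite dotvC dotv0r.
  move=> /p0 p00; apply/eqP; rewrite eq_sym -norm2_eq0 eq_le r0 andbT.
  by move: rp; rewrite p00 norm2_0 mulr0.
rewrite mulmx0 !norm2_0 mul0r addr0 subr0.
apply: (@le_trans _ _ (4 * (n%:R * K))); last by lra.
by apply: ler_pdiv_of_mul => //; [rewrite mulr_ge0 | lra].
Qed.

End Bounds.

Theorem theorem2p8 (R : realType) (c : {poly {poly R}}) :
  exists c' : {poly {poly R}},
  forall (u : R) (m n : nat) (A : 'M[R]_(m, n)) (b : 'cV[R]_m)
    (x xh : 'cV[R]_n) (us : 'I_n -> 'cV[R]_m) (sigma : 'I_n -> R)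
    (vs : 'I_n -> 'cV[R]_n),
  0 < u -> (n <= m)%N -> \rank A = n ->
  spectral_norm A = 1 -> norm2 b = 1 ->
  is_lstsq A b x -> is_svd A us sigma vs ->
  (backward_stable c u A b xh ->
     componentwise_error_bound c' u A b x xh sigma vs) /\
  (componentwise_error_bound c u A b x xh sigma vs ->
     backward_stable c' u A b xh).
Proof.
exists ((12%:R *: 'X)%:P * c) => u m n A b x xh us sigma vs u0 _ rA A1 b1 Ax svd.
have sigma_gt0 i := svd_sigma_gt0 svd i rA.
have F1 : 1 <= normF A by rewrite -A1 spectral_norm_le_normF.
have Fn : normF A <= n%:R by have := normF_le_spectral svd; rewrite A1 mulr1.
have n1 : 1 <= n%:R :> R by apply: le_trans Fn.
have pc' : prefactor ((12%:R *: 'X)%:P * c) m n = 12 * n%:R * prefactor c m n.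
  by rewrite /prefactor !(hornerM, hornerC, hornerZ, hornerX).
set C := prefactor c m n in pc'.
have x0 := norm2_ge0 xh; have r0 := norm2_ge0 (b - A *m xh).
have errE i : `|dotv (vs i) (xh - x)|
    = (sigma i)^-1 * `|dotv (us i) (b - A *m xh)|.
  have si := sigma_gt0 i; rewrite -[in RHS]normrN -(svd_error_component svd _ si Ax).
  by rewrite normrM (gtr0_norm si) mulKf // gt_eqF.
rewrite /backward_stable /componentwise_error_bound pc' -/C; split=> [BE i|CE].
  have [E adm [BEE _]] := backward_error_min A b xh; rewrite BEE in BE.
  have E0 := normF_ge0 E.
  (* Polynomials may take negative values; the bound itself excludes this. *)
  have C0 : 0 <= C.
    have := le_trans E0 BE; rewrite -mulrA pmulr_lge0 //.
    by rewrite mulr_gt0 // (lt_le_trans ltr01).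
  have EC : normF E <= C * n%:R * u.
    apply: le_trans BE _; apply: ler_wpM2r; first exact: ltW.
    exact: ler_wpM2l.
  rewrite errE; have si := sigma_gt0 i.
  have H := admissible_pert_residual_bound svd sigma_gt0 i adm.
  rewrite ler_pdivrMl //.
  rewrite -(ler_pM2l si); apply: le_trans H _.
  set S := sigma i * norm2 xh + norm2 _.
  have S0 : 0 <= S by rewrite addr_ge0 // mulr_ge0 // ltW.
  have -> : sigma i * (sigma i * (12 * n%:R * C *
      ((sigma i)^-1 * (1 + norm2 xh) * u + sigma i ^- 2 * norm2 (b - A *m xh) * u)))
      = 12 * (C * n%:R * u) * (S + sigma i).
    by rewrite /S; field; rewrite gt_eqF.
  have K0 : 0 <= C * n%:R * u by exact: le_trans EC.
  apply: (@le_trans _ _ (12 * (C * n%:R * u) * S)).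
    by rewrite ler_wpM2r //; lra.
  apply: ler_wpM2l; last by rewrite lerDl ltW.
  by rewrite mulr_ge0.
(* The sign of C follows from any one of the bounds, so an index is needed;
   n >= 1 because 1 <= |A|_F <= n. *)
have n_gt0 : (0 < n)%N by rewrite -(ltr0n R) (lt_le_trans ltr01).
pose i0 := Ordinal n_gt0.
have C0 : 0 <= C.
  have := le_trans (normr_ge0 _) (CE i0); rewrite pmulr_lge0 //.
  have si := sigma_gt0 i0.
  have : 0 < (sigma i0)^-1 * (1 + norm2 xh) * u.
    by rewrite !mulr_gt0 ?invr_gt0 // ltr_wpDr.
  have : 0 <= sigma i0 ^- 2 * norm2 (b - A *m xh) * u.
    by rewrite !mulr_ge0 ?invr_ge0 ?sqr_ge0 // ltW.
  by lra.
have Cu0 : 0 <= C * u by rewrite mulr_ge0 // ltW.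
have Axh : norm2 (A *m xh) <= norm2 xh.
  by have := norm2_mulmx_spectral A xh; rewrite A1 mul1r.
have rx1 : 1 <= norm2 (b - A *m xh) + norm2 xh.
  rewrite -b1 -{1}(subrK (A *m xh) b); apply: le_trans (norm2D _ _) _.
  by rewrite lerD2l.
apply: (@le_trans _ _ (6 * n%:R * (2 * (C * u)))); last first.
  rewrite (_ : 6 * _ * _ = 12 * n%:R * C * u * 1); last by ring.
  rewrite (_ : _ * normF A * u = 12 * n%:R * C * u * normF A); last by ring.
  by rewrite ler_wpM2l // -mulrA mulr_ge0 // mulr_ge0.
apply: (backward_error_le_residual svd sigma_gt0) => [|i]; first by rewrite mulr_ge0.
have si := sigma_gt0 i; have := CE i; rewrite errE.
set r := norm2 (b - A *m xh) in r0 rx1 *; set y := norm2 xh in x0 rx1 *.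
have si1 : sigma i <= 1 by rewrite -A1 (svd_sigma_le svd).
set rho := `|_| => CEi.
have -> : sigma i * rho = sigma i * sigma i * ((sigma i)^-1 * rho).
  by field; rewrite gt_eqF.
apply: (@le_trans _ _ (C * u * (sigma i * (1 + y) + r))).
  have -> : C * u * (sigma i * (1 + y) + r) = sigma i * sigma i *
      (C * ((sigma i)^-1 * (1 + y) * u + sigma i ^- 2 * r * u)).
    by field; rewrite gt_eqF.
  by rewrite ler_wpM2l // mulr_ge0 // ltW.
rewrite [leRHS](_ : _ = C * u * (2 * (sigma i * y + r))); last by ring.
rewrite ler_wpM2l // mulrDr mulr1.
(* The unit term is absorbed since 1 <= r + y and sigma i <= 1. *)
have : sigma i * 1 <= sigma i * (r + y) by rewrite ler_wpM2l // ltW.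
have : sigma i * r <= r by rewrite ler_piMl.
by rewrite mulr1 mulrDr; lra.
Qed.
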